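(* (Decks with two card types.) Let $D$ be a deck of $n$ cards with exactly two card values, $1$ and $2$, occurring $n_1\ge1$ and $n_2\ge1$ times. If the top and bottom cards of $D$ have the same value, i.e. $D(1)=D(n)$, then $c_1(D,D')=0$ for every reordering $D'$ of $D$, hence $\kappa_1(D)=0$, and the variation distance from uniform after an $a$-shuffle of $D$ satisfies $$\frac12\sum_{D'\in\mathcal O(D)}\left|\mathbb{P}_a(D\to D')-\frac1N\right|=O(a^{-2})$$ as $a\to\infty$ through positive integers.
   Context: A deck of $n$ cards is a function $D$ from $\{1,\dots,n\}$ to a set of values; position 1 is the top and position $n$ the bottom. A permutation $\pi\in S_n$ acts on decks by moving the card in position $i$ to position $\pi(i)$: $(\pi D)(\pi(i))=D(i)$. $\mathcal O(D)=\{\pi D:\pi\in S_n\}$ is the set of reorderings of $D$ and $N=\#\mathcal O(D)$. For a positive integer $a$, the $a$-shuffle distribution on $S_n$ is $\mathbb{P}_a(\pi)=\frac1{a^n}\binom{a+n-\operatorname{des}(\pi)-1}{n}$, where $\operatorname{des}(\pi)=\#\{1\le i\le n-1:\pi(i)>\pi(i+1)\}$, and $\mathbb{P}_a(D\to D')=\sum_{\pi\in S_n:\ \pi D=D'}\mathbb{P}_a(\pi)$. A $u$-$v$ digraph in $D$ is an index $i$ with $D(i)=u$, $D(i+1)=v$. A $u$-$v$ pair in $D$ is a pair $(i,j)$ with $i<j$, $D(i)=u$, $D(j)=v$. Define $W(D,u,v)=\#\{u\text{-}v\text{ digraphs in }D\}-\#\{v\text{-}u\text{ digraphs in }D\}$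 and $Z(D,u,v)=\#\{u\text{-}v\text{ pairs in }D\}-\#\{v\text{-}u\text{ pairs in }D\}$. For a deck with the two values $1,2$ and $D'\in\mathcal O(D)$, $$c_1(D,D')=\frac{n}{2n_1n_2N}W(D,1,2)Z(D',1,2),\qquad \kappa_1(D)=\frac12\sum_{D'\in\mathcal O(D)}|c_1(D,D')|.$$ *)

(* Defs.v *)
From mathcomp Require Import all_boot all_order all_algebra all_fingroup.
From mathcomp Require Import all_classical all_reals all_analysis.

Set Implicit Arguments.
Unset Strict Implicit.
Unset Printing Implicit Defensive.

Import Order.TTheory GRing.Theory Num.Theory.
Import numFieldNormedType.Exports.

Local Open Scope ring_scope.

(* Positions are 0-based: the top card is at index 0, the bottom at n.-1. *)
Definition deck (n : nat) (V : finType) := {ffun 'I_n -> V}.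

Definition permute_deck (n : nat) (V : finType) (pi : 'S_n) (D : deck n V) :
  deck n V := [ffun j => D ((pi^-1)%g j)].

(* The card in position i moves to position pi i. *)
Lemma permute_deckE (n : nat) (V : finType) (pi : 'S_n) (D : deck n V)
    (i : 'I_n) :
  permute_deck pi D (pi i) = D i.
Proof. by rewrite ffunE permK. Qed.

Definition reorderings (n : nat) (V : finType) (D : deck n V) :
  {set deck n V} := [set permute_deck pi D | pi : 'S_n].

Definition card_count (n : nat) (V : finType) (D : deck n V) (u : V) : nat :=
  #|[set i : 'I_n | D i == u]|.

(* In des and digraphs the ordinal j stands for position i + 1; requiring that
   it exist keeps i from being the last position. *)
Definition des (n : nat) (pi : 'S_n) : nat :=
  #|[set i : 'I_n | [exists j : 'I_n, (j == i.+1 :> nat) && (pi j < pi i)%N]]|.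

Definition digraphs (n : nat) (V : finType) (D : deck n V) (u v : V) : nat :=
  #|[set i : 'I_n |
      [exists j : 'I_n, [&& j == i.+1 :> nat, D i == u & D j == v]]]|.

Definition pairs (n : nat) (V : finType) (D : deck n V) (u v : V) : nat :=
  #|[set p : 'I_n * 'I_n | [&& (p.1 < p.2)%N, D p.1 == u & D p.2 == v]]|.

Definition W (n : nat) (V : finType) (D : deck n V) (u v : V) : int :=
  (digraphs D u v)%:Z - (digraphs D v u)%:Z.

Definition Z (n : nat) (V : finType) (D : deck n V) (u v : V) : int :=
  (pairs D u v)%:Z - (pairs D v u)%:Z.

(* For 0 < n we have des pi <= n - 1, so neither natural-number subtraction
   truncates. *)
Definition shuffle_prob (R : realType) (n a : nat) (pi : 'S_n) : R :=
  (a%:R ^+ n)^-1 * 'C(a + n - des pi - 1, n)%:R.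

Definition transition_prob (R : realType) (n : nat) (V : finType) (a : nat)
    (D D' : deck n V) : R :=
  \sum_(pi : 'S_n | permute_deck pi D == D') shuffle_prob R a pi.

(* u and v play the roles of the card values 1 and 2. *)
Definition c1 (R : realType) (n : nat) (V : finType) (u v : V)
    (D D' : deck n V) : R :=
  n%:R / (2 * (card_count D u)%:R * (card_count D v)%:R
            * #|reorderings D|%:R)
  * (W D u v)%:~R * (Z D' u v)%:~R.

Definition kappa1 (R : realType) (n : nat) (V : finType) (u v : V)
    (D : deck n V) : R :=
  2^-1 * \sum_(D' in reorderings D) `|c1 R u v D D'|.

Definition variation_distance (R : realType) (n : nat) (V : finType)
    (D : deck n V) (a : nat) : R :=
  2^-1 * \sum_(D' in reorderings D)
           `|transition_prob R a D D' - #|reorderings D|%:R^-1|.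

(* Main.v *)
Require Import Defs.
From mathcomp Require Import all_boot all_order all_algebra all_fingroup.
From mathcomp Require Import all_classical all_reals all_analysis.
From mathcomp Require Import ring lra zify.

Set Implicit Arguments.
Unset Strict Implicit.
Unset Printing Implicit Defensive.

Import Order.TTheory GRing.Theory Num.Theory.
Import numFieldNormedType.Exports.

Local Open Scope ring_scope.

(** Expanding the binomial coefficient gives
    P_a(pi) = 1/n! * (1 + n ((n-1)/2 - des pi) / a) + O(a^-2), so the claim is
    that (n-1)/2 - des pi sums to 0 over the permutations taking D to D'.
    This sum splits over the adjacent positions (i, i+1).  Exchanging equal
    cards permutes the fiber, so the term at (i, i+1) vanishes if
    D(i) = D(i+1), and otherwise is a constant depending only on D' times
    [D(i) = u] - [D(i+1) = u]; the sum telescopes to a multiple of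
    [D(1) = u] - [D(n) = u] = 0. *)

(** * Products: falling factorials and first-order expansion *)

Lemma natr_ffact (R : pzRingType) (N k : nat) :
  (N ^_ k)%:R = \prod_(i < k) (N%:R - i%:R) :> R.
Proof.
elim: k => [|k IHk]; first by rewrite ffactn0 big_ord0.
rewrite ffactnSr big_ord_recr /= -IHk natrM.
(* When [N < k] the truncated difference [N - k] is harmless, since [N ^_ k] is already 0. *)
have [le_kN|lt_Nk] := leqP k N; first by rewrite natrB.
by rewrite ffact_small // !mul0r.
Qed.

Lemma prod_1addM_expansion (R : realFieldType) (k : nat) (c : 'I_k -> R) :
  exists M : R, forall x : R, 0 <= x <= 1 ->
    `|\prod_(i < k) (1 + c i * x) - (1 + x * \sum_(i < k) c i)| <= M * x ^+ 2.
Proof.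
elim: k c => [|k IHk] c.
  by exists 0 => x _; rewrite !big_ord0 mulr0 addr0 subrr normr0 mul0r.
have [M HM] := IHk (fun i => c (widen_ord (leqnSn k) i)).
set S := \sum_(i < k) c (widen_ord (leqnSn k) i) in HM.
exists (`|c ord_max * S| + M * (1 + `|c ord_max|)) => x x01.
rewrite !big_ord_recr /= -/S.
set p := \prod_(i < k) _; set d := c ord_max.
have {HM} : `|p - (1 + x * S)| <= M * x ^+ 2 by apply: HM.
set e := p - _ => He.
(* The new error is a quadratic cross term plus the old error [e] times the last factor, which is at
   most [1 + |d|] in absolute value because [0 <= x <= 1]. *)
have -> : p * (1 + d * x) - (1 + x * (S + d)) = d * S * x ^+ 2 + e * (1 + d * x).
  by rewrite /e; ring.
have /andP[x0 x1] := x01.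
rewrite (le_trans (ler_normD _ _))// [leRHS]mulrDl lerD//.
  by rewrite normrM (ger0_norm (exprn_ge0 2 x0)).
rewrite normrM mulrAC ler_pM// (le_trans (ler_normD _ _))// normr1 lerD2l.
by rewrite normrM (ger0_norm x0) ler_piMr.
Qed.

(** * Sums over adjacent positions *)

Lemma telescope_ord (A : zmodType) (m : nat) (G : 'I_m.+1 -> A) :
  \sum_(i < m) (G (widen_ord (leqnSn m) i) - G (lift ord0 i)) =
  G ord0 - G ord_max.
Proof.
rewrite sumrB.
apply/eqP; rewrite subr_eq addrAC -[X in _ == X - _]big_ord_recl.
by rewrite big_ord_recr addrK.
Qed.

(** The last position has no successor and contributes nothing; for [i < m], [widen_ord _ i] and
    [lift ord0 i] are the positions i and i+1. This serves both [des] and [digraphs]. *)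
Lemma card_consecutive (m : nat) (P : rel 'I_m.+1) :
  #|[set i : 'I_m.+1 | [exists j : 'I_m.+1, (j == i.+1 :> nat) && P i j]]| =
  (\sum_(i < m) P (widen_ord (leqnSn m) i) (lift ord0 i))%N.
Proof.
rewrite -sum1_card big_mkcond big_ord_recr /= !inE.
have -> : [exists j : 'I_m.+1, (j == m.+1 :> nat) && P ord_max j] = false.
  apply/existsP => -[j /andP[/eqP jE _]].
  by have := ltn_ord j; rewrite jE ltnn.
rewrite addn0; apply: eq_bigr => i _; rewrite inE.
have -> : [exists j : 'I_m.+1, (j == i.+1 :> nat) && P (widen_ord (leqnSn m) i) j]
          = P (widen_ord (leqnSn m) i) (lift ord0 i).
  apply/existsP/idP => [[j /andP[/eqP jE]]|Pi].
    by have -> : j = lift ord0 i by apply: val_inj; rewrite /= jE.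
  by exists (lift ord0 i); rewrite Pi andbT.
by case: P.
Qed.

Lemma des_sum (m : nat) (pi : 'S_m.+1) :
  des pi = (\sum_(i < m)
    (pi (lift ord0 i) < pi (widen_ord (leqnSn m) i))%N)%N.
Proof. exact: (card_consecutive (fun i j => (pi j < pi i)%N)). Qed.

Lemma des_le (m : nat) (pi : 'S_m.+1) : (des pi <= m)%N.
Proof.
rewrite des_sum -[leqRHS]card_ord -sum1_card.
by apply: leq_sum => i _; case: (_ < _)%N.
Qed.

(** With only two values, the contribution of positions i and i+1 to [W] is [D(i) = u] -
    [D(i+1) = u]. *)
Lemma W_telescope (m : nat) (V : finType) (u v : V) (D : deck m.+1 V) :
  u != v -> (forall i, D i = u \/ D i = v) ->
  W D u v = (D ord0 == u)%:Z - (D ord_max == u)%:Z.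
Proof.
move=> uv Duv; rewrite -(telescope_ord (fun i => (D i == u)%:Z)) /W /digraphs.
rewrite (card_consecutive (fun i j => (D i == u) && (D j == v))).
rewrite (card_consecutive (fun i j => (D i == v) && (D j == u))).
rewrite !(big_morph Posz PoszD (erefl _)) -sumrB; apply: eq_bigr => i _.
have vu : (v == u) = false by rewrite eq_sym (negbTE uv).
case: (Duv (widen_ord _ i)) => ->; case: (Duv (lift ord0 i)) => ->;
  by rewrite !eqxx ?vu ?(negbTE uv).
Qed.

(** * Fibers of the action on decks *)

Lemma permute_deckM (n : nat) (V : finType) (s t : 'S_n) (D : deck n V) :
  permute_deck t (permute_deck s D) = permute_deck (s * t)%g D.
Proof. by apply/ffunP => j; rewrite !ffunE invMg permM. Qed.

(** Orbit-stabilizer: each fiber is a right coset of the stabilizer of [D], so the fibers partition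
    the symmetric group into parts of equal size. *)
Lemma card_permute_deck_fiber (n : nat) (V : finType) (D D' : deck n V) :
  D' \in reorderings D ->
  (#|[set pi : 'S_n | permute_deck pi D == D']| * #|reorderings D| = n`!)%N.
Proof.
have fiberE E : E \in reorderings D ->
    #|[set pi : 'S_n | permute_deck pi D == E]| =
    #|[set pi : 'S_n | permute_deck pi D == D]|.
  case/imsetP => s _ ->.
  rewrite -(card_imset [set pi : 'S_n | permute_deck pi D == D] (mulIg s)).
  apply: eq_card => pi; rewrite inE; apply/eqP/imsetP => [Epi|[t]].
    exists (pi * s^-1)%g; last by rewrite mulgKV.
    by rewrite inE -permute_deckM Epi permute_deckM mulgV;
       apply/eqP/ffunP => j; rewrite ffunE invg1 perm1.
  by rewrite inE => /eqP tD ->; rewrite -permute_deckM tD.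
move=> D'in; rewrite -card_Sn -[RHS]sum1_card.
rewrite (partition_big (fun pi => permute_deck pi D) (mem (reorderings D))) /=.
  rewrite (eq_bigr (fun=> #|[set pi : 'S_n | permute_deck pi D == D']|)).
    by rewrite sum_nat_const mulnC.
  by move=> E Ein; rewrite sum1_card (fiberE D')// -(fiberE E)//;
     apply: eq_card => pi; rewrite !inE.
by move=> pi _; apply: imset_f.
Qed.

(** * Descents averaged over a fiber *)

Section DescentBias.
Variables (R : realFieldType) (m : nat) (V : finType) (D D' : deck m.+1 V).

(** Subtracting 1/2 makes this antisymmetric in i and j. The positions need not be adjacent, so
    transpositions can move them freely. *)
Let bias (i j : 'I_m.+1) : R :=
  \sum_(pi : 'S_m.+1 | permute_deck pi D == D') ((pi j < pi i)%N%:R - 2^-1).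

Let biasC (i j : 'I_m.+1) : i != j -> bias j i = - bias i j.
Proof.
move=> ij; apply/eqP; rewrite -addr_eq0 -big_split /= big1// => pi _.
have [_|_|/val_inj/perm_inj ijE] := ltngtP (pi i) (pi j).
- by rewrite mulr1n mulr0n; field.
- by rewrite mulr1n mulr0n; field.
- by rewrite ijE eqxx in ij.
Qed.

(* Precomposing with a permutation of equal cards maps the fiber over D' to
   itself. *)
Let bias_tperm (i j k l : 'I_m.+1) : D k = D l ->
  bias (tperm k l i) (tperm k l j) = bias i j.
Proof.
move=> Dkl; rewrite /bias (reindex_inj (mulgI (tperm k l))) /=.
apply: eq_big => [pi|pi _]; last by rewrite !permM !tpermK.
rewrite -permute_deckM; congr (permute_deck pi _ == _); apply/ffunP => x.
by rewrite ffunE tpermV; case: tpermP => // ->.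
Qed.

Let bias_eq0 (i j : 'I_m.+1) : i != j -> D i = D j -> bias i j = 0.
Proof.
move=> ij Dij; have := bias_tperm i j Dij; rewrite tpermL tpermR biasC//.
by move=> h; lra.
Qed.

(** Move i to k, then j to l; as the two values differ, each transposition fixes the other
    position. *)
Let bias_eq (i j k l : 'I_m.+1) : D i = D k -> D j = D l -> D i != D j ->
  bias i j = bias k l.
Proof.
move=> Dik Djl Dij.
have neqD x y : D x != D y -> x != y by apply: contra_neq => ->.
rewrite -(bias_tperm i j Dik) tpermL [tperm i k j]tpermD ?neqD//; last first.
  by rewrite -Dik.
rewrite -(bias_tperm k j Djl) tpermL tpermD ?neqD//.
  by rewrite -Dik eq_sym.
by rewrite -Dik -Djl eq_sym.
Qed.

Lemma sum_des_fiber (u v : V) :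
  u != v -> (forall i, D i = u \/ D i = v) ->
  (exists i, D i = u) -> (exists j, D j = v) -> D ord0 = D ord_max ->
  \sum_(pi : 'S_m.+1 | permute_deck pi D == D') (m%:R / 2 - (des pi)%:R) = 0 :> R.
Proof.
move=> uv Duv [i0 Di0] [j0 Dj0] D0m.
have -> : \sum_(pi : 'S_m.+1 | permute_deck pi D == D') (m%:R / 2 - (des pi)%:R)
    = - \sum_(i < m) bias (widen_ord (leqnSn m) i) (lift ord0 i).
  rewrite exchange_big /= -sumrN; apply: eq_bigr => pi _.
  rewrite des_sum sumrB natr_sum opprB sumr_const card_ord.
  by rewrite -[2^-1 *+ _]mulr_natl.
(* [bias i0 j0] is the common bias of all positions holding u and v in this order; the reverse order
   gives its negative. *)
pose G i : R := bias i0 j0 * (D i == u)%:R.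
rewrite (eq_bigr (fun i => G (widen_ord (leqnSn m) i) - G (lift ord0 i))).
  by rewrite telescope_ord /G D0m subrr oppr0.
move=> i _; set k := widen_ord _ i; set l := lift ord0 i.
have kl : k != l by rewrite -(inj_eq val_inj) /= /bump /= add1n neq_ltn ltnSn.
have vu : (v == u) = false by rewrite eq_sym (negbTE uv).
rewrite /G -mulrBr.
case: (Duv k) => Dk; case: (Duv l) => Dl; rewrite Dk Dl ?eqxx ?vu.
- by rewrite subrr mulr0 bias_eq0// Dk Dl.
- by rewrite subr0 mulr1; apply: bias_eq; rewrite ?Dk ?Dl.
- rewrite sub0r mulrN1 biasC 1?eq_sym//; congr (- _).
  by apply: bias_eq; rewrite ?Dk ?Dl.
- by rewrite subrr mulr0 bias_eq0// Dk Dl.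
Qed.

End DescentBias.

(** * Shuffle probabilities to first order in 1/a *)

Lemma shuffle_prob_prod (R : realType) (m a : nat) (pi : 'S_m.+1) : (0 < a)%N ->
  shuffle_prob R a pi =
  (m.+1)`!%:R^-1 *
    \prod_(k < m.+1) (1 + (m%:R - (des pi)%:R - k%:R) * a%:R^-1).
Proof.
move=> a0; have aN0 : a%:R != 0 :> R by rewrite pnatr_eq0 -lt0n.
have fN0 : (m.+1)`!%:R != 0 :> R by rewrite pnatr_eq0 -lt0n fact_gt0.
apply: (mulfI fN0); rewrite mulVKf// /shuffle_prob mulrCA -natrM [(_`! * _)%N]mulnC.
rewrite bin_ffact natr_ffact.
have -> : (a + m.+1 - des pi - 1 = a + (m - des pi))%N by have := des_le pi; lia.
rewrite natrD natrB ?des_le//.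
rewrite -[in a%:R ^+ _](card_ord m.+1) -prodr_const -prodfV -big_split /=.
by apply: eq_bigr => k _; field.
Qed.

Lemma shuffle_prob_expansion (R : realType) (m : nat) (pi : 'S_m.+1) :
  exists M : R, forall a : nat, (0 < a)%N ->
    `|shuffle_prob R a pi - (m.+1)`!%:R^-1 *
        (1 + a%:R^-1 * (m.+1%:R * (m%:R / 2 - (des pi)%:R)))| <= M * a%:R ^- 2.
Proof.
have [M HM] :=
  prod_1addM_expansion (fun k : 'I_m.+1 => m%:R - (des pi)%:R - k%:R : R).
exists ((m.+1)`!%:R^-1 * M) => a a0; rewrite shuffle_prob_prod//.
(* The mean of k over [k < m.+1] is m/2, which centers [des pi]. *)
have sumE : \sum_(k < m.+1) (m%:R - (des pi)%:R - k%:R)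
    = m.+1%:R * (m%:R / 2 - (des pi)%:R) :> R.
  have sumk : \sum_(k < m.+1) k%:R = m.+1%:R * m%:R / 2 :> R.
    elim: (m) => [|j IHj]; first by rewrite big_ord1 mulr0 mul0r.
    by rewrite big_ord_recr /= IHj -!natr1; field.
  by rewrite sumrB sumk sumr_const card_ord -[_ *+ m.+1]mulr_natl; field.
rewrite -mulrBr normrM ger0_norm ?invr_ge0 ?ler0n// -mulrA.
rewrite ler_wpM2l ?invr_ge0 ?ler0n// -sumE -exprVn; apply: HM.
by rewrite invr_ge0 ler0n invf_le1 ?ltr0n// ler1n.
Qed.

Lemma transition_prob_bound (R : realType) (m : nat) (V : finType) (u v : V)
    (D : deck m.+1 V) :
  u != v -> (forall i, D i = u \/ D i = v) ->
  (exists i, D i = u) -> (exists j, D j = v) -> D ord0 = D ord_max ->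
  exists M : R, forall a D', (0 < a)%N -> D' \in reorderings D ->
    `|transition_prob R a D D' - #|reorderings D|%:R^-1| <= M * a%:R ^- 2.
Proof.
move=> uv Duv hu hv D0m.
have [M HM] := fin_all_exists (@shuffle_prob_expansion R m).
(* Summing over all permutations, not just one fiber, gives a constant independent of [D']. *)
exists (\sum_pi `|M pi|) => a D' a0 D'in.
have N0 : #|reorderings D|%:R != 0 :> R.
  by rewrite pnatr_eq0 -lt0n card_gt0; apply/set0Pn; exists D'.
have fN0 : (m.+1)`!%:R != 0 :> R by rewrite pnatr_eq0 -lt0n fact_gt0.
pose L (pi : 'S_m.+1) : R := (m.+1)`!%:R^-1 *
  (1 + a%:R^-1 * (m.+1%:R * (m%:R / 2 - (des pi)%:R))).
(* The first-order terms cancel over the fiber, and the constant terms give its size over (m+1)!,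
   that is 1/N. *)
have -> : #|reorderings D|%:R^-1
    = \sum_(pi : 'S_m.+1 | permute_deck pi D == D') L pi.
  rewrite -mulr_sumr big_split /= -!mulr_sumr (sum_des_fiber _ _ uv)//.
  rewrite !mulr0 addr0 sumr_const -cardsE.
  move: fN0; rewrite -(card_permute_deck_fiber D'in) natrM mulf_eq0 negb_or.
  by case/andP => K0 _; field; rewrite K0 N0.
rewrite -sumrB (le_trans (ler_norm_sum _ _ _))//.
rewrite mulr_suml [leLHS]big_mkcond /= ler_sum// => pi _.
have M0 : 0 <= `|M pi| * a%:R ^- 2 by rewrite mulr_ge0// invr_ge0 exprn_ge0.
case: ifP => // _; apply: (le_trans (HM pi a a0)).
by rewrite ler_wpM2r ?ler_norm// invr_ge0 exprn_ge0.
Qed.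

Local Open Scope classical_set_scope.

Theorem mainTheorem7 (R : realType) (n : nat) (V : finType) (u v : V)
    (D : deck n V)
    (huv : u != v)
    (hval : forall i : 'I_n, D i = u \/ D i = v)
    (hu : (1 <= card_count D u)%N)
    (hv : (1 <= card_count D v)%N)
    (htopbottom : forall i j : 'I_n,
      i = 0%N :> nat -> j = n.-1 :> nat -> D i = D j) :
  [/\ forall D' : deck n V, D' \in reorderings D -> c1 R u v D D' = 0,
      kappa1 R u v D = 0 &
      (fun a : nat => variation_distance R D a)
        =O_\oo (fun a : nat => (a%:R : R) ^- 2)].
Proof.
have occurs w : (1 <= card_count D w)%N -> exists i, D i = w.
  by rewrite card_gt0 => /set0Pn[i]; rewrite inE => /eqP; exists i.
case: n => [|m] in D hval hu hv htopbottom occurs *.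
  by have [[]] := occurs u hu.
have D0m : D ord0 = D ord_max by exact: htopbottom.
have c1_0 D' : c1 R u v D D' = 0.
  by rewrite /c1 W_telescope// D0m subrr mulr0 mul0r.
split => [D' _||]; first exact: c1_0.
  by rewrite /kappa1 big1 ?mulr0// => D' _; rewrite c1_0 normr0.
have [M HM] :=
  transition_prob_bound R huv hval (occurs u hu) (occurs v hv) D0m.
pose B : R := 2^-1 * (#|reorderings D|%:R * M).
(* The constant must be positive, while the sign of [B] is unknown; the bound is claimed from a = 1
   on. *)
apply/eqO_exP; exists (`|B| + 1) => //; exists 1%N => // a /= a0.
have a2 : 0 <= a%:R ^- 2 :> R by rewrite invr_ge0 exprn_ge0.
have leB : B <= `|B| + 1 by rewrite ler_wpDr// ler_norm.
rewrite (ger0_norm a2) ger0_norm; last first.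
  by rewrite mulr_ge0 ?sumr_ge0 ?invr_ge0 ?ler0n.
apply: le_trans (ler_wpM2r a2 leB).
rewrite /variation_distance /B -!mulrA ler_wpM2l ?invr_ge0 ?ler0n//.
rewrite [leRHS]mulr_natl -[leRHS]sumr_const; apply: ler_sum => D' D'in.
exact: HM.
Qed.
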